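(* For any prime $p>3$, the following three congruences hold: $$\sum_{k=0}^{(p-1)/2}\frac{\binom{2k}{k}}{16^k}T_{2k}(4,1)\equiv 1\pmod{p^2},$$ $$\sum_{k=0}^{(p-1)/2}\frac{\binom{2k}{k}}{4^k}T_{2k}(3,4)\equiv\left(\frac{-1}{p}\right)\frac{7-3^p}{4}\pmod{p^2},$$ $$\sum_{k=0}^{(p-1)/2}\frac{\binom{2k}{k}}{16^k}T_{2k}(8,9)\equiv\left(\frac{3}{p}\right)\pmod{p^2}.$$
   Context: For $n\in\mathbb{N}=\{0,1,2,\ldots\}$ and $b,c\in\mathbb{C}$, the generalized central trinomial coefficient is $T_n(b,c)=[x^n](x^2+bx+c)^n=\sum_{j=0}^{\lfloor n/2\rfloor}\binom{n}{2j}\binom{2j}{j}b^{n-2j}c^j$. The symbol $\left(\frac{\cdot}{p}\right)$ is the Legendre symbol. Congruences between rational numbers modulo $p^2$ are understood in the ring of rational numbers whose denominators are prime to $p$ (equivalently in $\mathbb{Z}_p$). *)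

(* Defs.v *)
From HB Require Import structures.
From mathcomp Require Import all_boot all_order all_algebra.

Set Implicit Arguments.
Unset Strict Implicit.
Unset Printing Implicit Defensive.

Import Order.TTheory GRing.Theory Num.Theory.
Local Open Scope ring_scope.

Definition central_trinomial (R : comNzRingType) (n : nat) (b c : R) : R :=
  (('X^2 + b *: 'X + c%:P) ^+ n)`_n.

(* Meaningful for p an odd prime. *)
Definition legendre (p : nat) (a : int) : int :=
  if (p%:Z %| a)%Z then 0
  else if [exists x : 'I_p, ((x%:Z ^+ 2 == a %[mod p%:Z])%Z)] then 1
  else -1.

Definition pintegral (p : nat) (x : rat) : bool := coprime p `|denq x|%N.

(* x = y modulo the ideal generated by m in the ring of p-integral rationals;
   both sides are required to lie in that ring. *)
Definition eqmod_pint (p m : nat) (x y : rat) : Prop :=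
  [/\ pintegral p x, pintegral p y &
      exists2 z : rat, pintegral p z & x - y = m%:R * z].

(* Main.v *)
Require Import Defs.
From HB Require Import structures.
From mathcomp Require Import all_boot all_order all_algebra.
From mathcomp Require Import cyclic finfield ring zify.

Set Implicit Arguments.
Unset Strict Implicit.
Unset Printing Implicit Defensive.

Import Order.TTheory GRing.Theory Num.Theory.
Local Open Scope ring_scope.

(** Write p = 2n+1, and let CT denote the constant term in x, so that
    T_m(b,c) = CT (x + b + c/x)^m.  All three sums have the shape
      S(d) = sum_(k <= n) C(2k,k) / 16^k T_{2k}(2d+2, d^2):
    take d = 1 and d = 3 for the first and the third; for the second,
    T_{2k}(-6,16) = 4^k T_{2k}(3,4) (substitute -2x for x) turns 4^k into 16^k,
    and d = -4.

    1. From C(n+k,2k) = C(2k,k) / (-16)^k prod_(j <= k) (1 - p^2/(2j-1)^2) one may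
    replace C(2k,k)/16^k by (-1)^k C(n+k,2k) modulo p^2 ([central_bin_cong]).

    2. With y = x + b + c/x, sum_k (-1)^k C(n+k,2k) y^(2k) is, up to (-1)^n, the
    Chebyshev polynomial U_{p-1}(y/2).  Expanding it at y = 2 instead gives
    sum_(k < p) C(p+k,2k+1) (y-2)^k ([morgan_voyce_double]).  For b = 2d+2, c = d^2
    we have y - 2 = (x+d)^2/x, whose k-th power has constant term C(2k,k) d^k.
    Hence the exact identity [central_trinomial_sum].

    3. C(p+k,2k+1) C(2k,k) = (-1)^k p/(2k+1) prod_(j <= k) (1 - p^2/j^2), so
    modulo p^2 only sum_(k < p) p/(2k+1) a^k with a = -d remains
    ([odd_bin_central_cong]).

    4. For 0 < j < p, both p/j and p/(p+j) are congruent to (-1)^(j-1) C(p,j)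
    modulo p^2.  Odd denominators below p thus produce the odd-index binomials,
    those above p the even-index ones: with (1 + sqrt a)^p = E + O sqrt a,
      S(d) = (-1)^n (O + a^n (1 - E))   modulo p^2     ([trinomial_sum_cong]).

    5. It remains to compute E and O.  For a = -1, (1+i)^2 = 2i gives
    O = (-1)^n E.  For a = 4, 1 + sqrt a and 1 - sqrt a are 3 and -1.  For a = -3,
    (1 + sqrt a)^6 = 64, so E = 4^n and O = s 4^n with s = 1 or -1.
    Modulo p one has O = a^n and 4^n = 1; this makes the p-divisible factors appear
    in pairs and, through Euler's criterion ([legendre_euler]), identifies the
    signs with Legendre symbols. *)

(** * Congruences between p-integral rationals *)

(** Closure under the ring operations is immediate for this description, where
    the denominator need not be the reduced one. *)
Lemma pintegralP (p : nat) (x : rat) :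
  reflect (exists2 d : nat, coprime p d & x * d%:R \is a Num.int)
          (x \in pintegral p).
Proof.
apply: (iffP idP) => [xP | [d pd /intrP[z xdz]]].
  exists `|denq x|%N => //; apply/intrP; exists (numq x).
  rewrite -[X in X * _]divq_num_den natr_absz gtr0_norm ?denq_gt0 //.
  by rewrite divfK // intr_eq0 denq_neq0.
have dv : (denq x %| d%:Z)%Z.
  have e : numq x * d%:Z = z * denq x.
    apply: (@intr_inj rat); rewrite !rmorphM /= -xdz.
    rewrite -{2}(divq_num_den x) -[d%:~R]pmulrn.
    by field; rewrite intr_eq0 denq_neq0.
  have : (denq x %| numq x * d%:Z)%Z by rewrite e dvdz_mull.
  by rewrite Gauss_dvdzr // /coprimez gcdzC; exact: coprime_num_den.
by rewrite -topredE /= /pintegral; apply: (coprime_dvdr dv).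
Qed.

Lemma pintegral_subring (p : nat) : subring_closed (pintegral p).
Proof.
split.
- by apply/pintegralP; exists 1%N; rewrite ?coprimen1 // mulr1.
- move=> x y /pintegralP[d pd xd] /pintegralP[e pe ye].
  apply/pintegralP; exists (d * e)%N; first by rewrite coprimeMr pd.
  have -> : (x - y) * (d * e)%N%:R = (x * d%:R) * e%:R - (y * e%:R) * d%:R
    by rewrite natrM; ring.
  by rewrite rpredB // rpredM // rpred_nat.
- move=> x y /pintegralP[d pd xd] /pintegralP[e pe ye].
  apply/pintegralP; exists (d * e)%N; first by rewrite coprimeMr pd.
  have -> : x * y * (d * e)%N%:R = (x * d%:R) * (y * e%:R)
    by rewrite natrM; ring.
  by rewrite rpredM.
Qed.

HB.instance Definition _ (p : nat) :=
  GRing.isSubringClosed.Build rat (pintegral p) (pintegral_subring p).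

Lemma pintegral_inv (p d : nat) : coprime p d -> d%:R^-1 \in pintegral p.
Proof.
move=> pd; apply/pintegralP; exists d => //.
by case: (eqVneq d 0%N) => [->|d0];
  rewrite ?mulr0 ?rpred0 // mulVf ?pnatr_eq0 ?rpred1.
Qed.

Lemma pintegral_inv_lt (p d : nat) :
  prime p -> (0 < d < p)%N -> d%:R^-1 \in pintegral p.
Proof.
move=> p_pr /andP[d0 dp]; apply: pintegral_inv.
by rewrite prime_coprime // gtnNdvd.
Qed.

(** Unlike [eqmod_pint], this relation does not ask its two sides to be
    p-integral, so it passes through sums and products with no side condition
    on the terms being compared. *)
Definition pcong (p m : nat) (x y : rat) : bool :=
  (x - y) / m%:R \in pintegral p.

Lemma pcong_refl p m x : pcong p m x x.
Proof. by rewrite /pcong subrr mul0r rpred0. Qed.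

Lemma pcong_sym p m x y : pcong p m x y -> pcong p m y x.
Proof. by rewrite /pcong => h; rewrite -opprB mulNr rpredN. Qed.

Lemma pcong_trans p m y x z : pcong p m x y -> pcong p m y z -> pcong p m x z.
Proof.
rewrite /pcong => h1 h2.
have -> : x - z = (x - y) + (y - z) by ring.
by rewrite mulrDl rpredD.
Qed.

Lemma pcongD p m x y x' y' :
  pcong p m x y -> pcong p m x' y' -> pcong p m (x + x') (y + y').
Proof.
rewrite /pcong => h1 h2.
have -> : x + x' - (y + y') = (x - y) + (x' - y') by ring.
by rewrite mulrDl rpredD.
Qed.

Lemma pcongMl p m a x y :
  a \in pintegral p -> pcong p m x y -> pcong p m (a * x) (a * y).
Proof. by rewrite /pcong => h1 h2; rewrite -mulrBr -mulrA rpredM. Qed.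

Lemma pcongMr p m a x y :
  a \in pintegral p -> pcong p m x y -> pcong p m (x * a) (y * a).
Proof. by rewrite ![_ * a]mulrC; exact: pcongMl. Qed.

Lemma pcong_sum p m (I : Type) (r : seq I) (P : pred I) (F G : I -> rat) :
  (forall i, P i -> pcong p m (F i) (G i)) ->
  pcong p m (\sum_(i <- r | P i) F i) (\sum_(i <- r | P i) G i).
Proof.
move=> h; apply: (big_ind2 (pcong p m)) => //; first exact: pcong_refl.
by move=> *; exact: pcongD.
Qed.

Lemma pcong_int p m (x y : int) :
  (m%:Z %| x - y)%Z -> pcong p m x%:~R y%:~R.
Proof.
move=> /dvdzP[q e]; rewrite /pcong -rmorphB e rmorphM /=.
case: (eqVneq m 0%N) => [->|m0]; first by rewrite invr0 mulr0 rpred0.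
by rewrite mulfK ?rpred_int // -pmulrn pnatr_eq0.
Qed.

Lemma pcong_eqmod_pint p m x y :
  (0 < m)%N -> y \in pintegral p -> pcong p m x y -> eqmod_pint p m x y.
Proof.
move=> m0 yP h; have m0' : m%:R != 0 :> rat by rewrite pnatr_eq0 -lt0n.
have e : x - y = m%:R * ((x - y) / m%:R) by rewrite mulrC divfK.
split => //; last by exists ((x - y) / m%:R).
have -> : x = y + m%:R * ((x - y) / m%:R) by rewrite -e; ring.
exact: (rpredD yP (rpredM (rpred_nat _ _) h)).
Qed.

(** * Fermat's theorem and Euler's criterion *)

Lemma Fp_expf_pred (p m : nat) (x : 'F_p) :
  prime p -> p = m.+1 -> x != 0 -> x ^+ m = 1.
Proof.
move=> p_pr pE x0; apply: (mulfI x0); rewrite mulr1 -exprS -pE.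
by have := expf_card x; rewrite card_Fp.
Qed.

Lemma fermat_int (p : nat) (a : int) : prime p -> (p%:Z %| a ^+ p - a)%Z.
Proof.
move=> p_pr; rewrite (dvdz_pcharf (pchar_Fp p_pr)) rmorphB rmorphXn subr_eq0.
by have /eqP := expf_card (a%:~R : 'F_p); rewrite card_Fp.
Qed.

Lemma fermat_four (p n : nat) :
  prime p -> p = n.*2.+1 -> (p%:Z %| 4 ^+ n - 1)%Z.
Proof.
move=> p_pr pE; have := fermat_int 2 p_pr.
have -> : 2 ^+ p - 2 = 2%:Z * (4 ^+ n - 1) :> int.
  by rewrite {1}pE exprS -mul2n exprM; ring.
rewrite Gauss_dvdzr // coprimezE /= prime_coprime // gtnNdvd //.
by move: p_pr; rewrite pE; case: (n).
Qed.

(** If z generates the cyclic group of nonzero residues and a = z^i, then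
    a^n = 1 forces 2n to divide i n, so that i is even. *)
Lemma Fp_square_of_euler (p n : nat) (a : 'F_p) :
  prime p -> p = n.*2.+1 -> a ^+ n = 1 -> exists x : 'F_p, x ^+ 2 = a.
Proof.
move=> p_pr pE an1.
have F1 (y : 'F_p) : y != 0 -> y ^+ n.*2 = 1.
  exact: Fp_expf_pred.
have n0 : (0 < n.*2)%N by rewrite double_gt0; case: (n) pE p_pr => // ->.
have [z zP] : {z : 'F_p | n.*2.-primitive_root z}.
  pose rs := [seq x <- enum 'F_p | x != 0].
  have : has n.*2.-primitive_root rs.
    apply: has_prim_root => //.
    - apply/allP => x; rewrite mem_filter => /andP[x0 _].
      by apply/unity_rootP; exact: F1.
    - by rewrite filter_uniq // enum_uniq.
    - rewrite size_filter -(leq_add2l (count (pred1 0) (enum 'F_p))).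
      rewrite (count_predC (pred1 0)) -cardT card_Fp // pE.
      by rewrite count_uniq_mem ?enum_uniq // mem_enum inE.
  by move=> /hasP/sig2W[z _ zP]; exists z.
have a0 : a != 0.
  apply/eqP => a0; move: an1; rewrite a0 expr0n.
  by rewrite -double_eq0 -[_ == _]negbK -lt0n n0 => /eqP; rewrite eq_sym oner_eq0.
have [[i /= _] ai] := prim_rootP zP (F1 a a0).
have : z ^+ (i * n) == 1 by rewrite exprM -ai an1.
rewrite -(prim_order_dvd zP) -mul2n dvdn_pmul2r; last by rewrite -double_gt0.
by move=> /dvdnP[k ik]; exists (z ^+ k); rewrite -exprM -ik ai.
Qed.

Lemma legendre_euler (p n : nat) (a s : int) :
  prime p -> p = n.*2.+1 -> (s == 1) || (s == -1) ->
  (p%:Z %| a ^+ n - s)%Z -> legendre p a = s.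
Proof.
move=> p_pr pE sP.
have p2 : (2 < p)%N by move: p_pr; rewrite pE; case: (n).
have s2 : s * s = 1 by case/orP: sP => /eqP ->.
have chp := pchar_Fp p_pr.
have n0 : n != 0%N by case: (n) pE p2 => // ->.
rewrite (dvdz_pcharf chp) rmorphB rmorphXn /= subr_eq0 => /eqP an.
have sF0 : s%:~R != 0 :> 'F_p.
  by apply/eqP => s0; move: (congr1 (fun t : int => t%:~R : 'F_p) s2);
     rewrite rmorphM /= s0 mul0r => /eqP; rewrite eq_sym oner_eq0.
rewrite /legendre (dvdz_pcharf chp); case: eqP => [a0|_].
  by move: sF0; rewrite -an a0 expr0n (negbTE n0) eqxx.
have sqE (x : int) :
    (x ^+ 2 == a %[mod p%:Z])%Z = (x%:~R ^+ 2 == a%:~R :> 'F_p).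
  by rewrite eqz_mod_dvd (dvdz_pcharf chp) rmorphB rmorphXn subr_eq0.
case: existsP => [[x]|nx].
  rewrite sqE => /eqP xa.
  case/orP: sP => /eqP sE //.
  (* s = -1 would give -1 = x^(p-1) = 1 in the field *)
  have x0 : (x%:~R : 'F_p) != 0.
    by apply: contraNneq sF0 => x0; rewrite -an -xa x0 expr0n expr0n (negbTE n0).
  have : (s%:~R : 'F_p) = 1.
    by rewrite -an -xa -exprM mul2n (Fp_expf_pred p_pr pE x0).
  move/eqP; rewrite sE -subr_eq0 -(rmorphB _ (-1) 1) -(dvdz_pcharf chp).
  by rewrite dvdzE /= => /dvdn_leq -/(_ isT); lia.
case/orP: sP => /eqP sE //; case: nx.
have [x xa] : exists x : 'F_p, x ^+ 2 = a%:~R.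
  by apply: (Fp_square_of_euler p_pr pE); rewrite an sE.
have xp : (x < p)%N by rewrite -[X in (_ < X)%N](card_Fp p_pr) card_ord.
exists (Ordinal xp); rewrite sqE -xa /=.
by rewrite -pmulrn natr_Zp.
Qed.

(** * Two expansions of a Chebyshev polynomial *)

(** The two kinds of Morgan-Voyce polynomials: Chebyshev polynomials expanded
    at the point 2.  As polynomials in u, [morgan_voyce_B m] is
    U_m((u+2)/2), and [morgan_voyce_b m.+1] is the difference of
    [morgan_voyce_B m.+1] and [morgan_voyce_B m]. *)
Definition morgan_voyce_b (R : comNzRingType) (m : nat) (u : R) : R :=
  \sum_(k < m.+1) 'C(m + k, k.*2)%:R * u ^+ k.

Definition morgan_voyce_B (R : comNzRingType) (m : nat) (u : R) : R :=
  \sum_(k < m.+1) 'C(m.+1 + k, k.*2.+1)%:R * u ^+ k.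

Lemma morgan_voyce_bS (R : comNzRingType) m (u : R) :
  morgan_voyce_b m.+1 u = morgan_voyce_b m u + u * morgan_voyce_B m u.
Proof.
have -> : morgan_voyce_b m u = \sum_(k < m.+2) 'C(m + k, k.*2)%:R * u ^+ k.
  by rewrite big_ord_recr /= bin_small ?mul0r ?addr0 // addnS doubleS -addnn.
rewrite /morgan_voyce_b /morgan_voyce_B [LHS]big_ord_recl [in RHS]big_ord_recl.
rewrite !addn0 double0 !bin0 -addrA; congr (_ + _).
rewrite mulr_sumr -big_split /=; apply: eq_bigr => k _.
by rewrite /bump /= add1n !addnS !addSn doubleS binS natrD exprS; ring.
Qed.

Lemma morgan_voyce_BS (R : comNzRingType) m (u : R) :
  morgan_voyce_B m.+1 u = morgan_voyce_b m.+1 u + morgan_voyce_B m u.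
Proof.
have -> : morgan_voyce_B m u =
    \sum_(k < m.+2) 'C(m.+1 + k, k.*2.+1)%:R * u ^+ k.
  rewrite [RHS]big_ord_recr /= bin_small ?mul0r ?addr0 //.
  by rewrite doubleS -addnn !addSn !addnS.
rewrite /morgan_voyce_b /morgan_voyce_B -big_split /=; apply: eq_bigr => k _.
by rewrite addSn binS natrD; ring.
Qed.

Lemma morgan_voyce_b0 (R : comNzRingType) (u : R) : morgan_voyce_b 0 u = 1.
Proof. by rewrite /morgan_voyce_b big_ord1 mulr1. Qed.

Lemma morgan_voyce_B0 (R : comNzRingType) (u : R) : morgan_voyce_B 0 u = 1.
Proof. by rewrite /morgan_voyce_B big_ord1 mulr1. Qed.

(** With y = u + 2, the first equation compares the expansions of U_{2n}(y/2) in
    powers of y - 2 and of y.  Two steps of the recursion at u act on these pairs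
    as one step at - y^2; the second equation makes the induction go
    through. *)
Lemma morgan_voyce_double (R : comNzRingType) n (u : R) :
  morgan_voyce_B n.*2 u = (-1) ^+ n * morgan_voyce_b n (- (u + 2) ^+ 2) /\
  morgan_voyce_B n.*2.+1 u =
    (-1) ^+ n * (u + 2) * morgan_voyce_B n (- (u + 2) ^+ 2).
Proof.
elim: n => [|n [IHe IHo]].
  rewrite morgan_voyce_BS morgan_voyce_bS !morgan_voyce_b0 !morgan_voyce_B0.
  by split; ring.
set w := - (u + 2) ^+ 2 in IHe IHo *.
have IHo' : morgan_voyce_b n.*2.+1 u =
    morgan_voyce_B n.*2.+1 u - morgan_voyce_B n.*2 u.
  by rewrite morgan_voyce_BS addrK.
rewrite doubleS !(morgan_voyce_BS _.+1, morgan_voyce_bS _.+1).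
rewrite (morgan_voyce_BS n) (morgan_voyce_bS n) IHo' IHo IHe.
move: (morgan_voyce_b n w) (morgan_voyce_B n w) => g f.
by rewrite (exprS (-1)) /w; split; ring.
Qed.

(** * Central trinomial coefficients *)

(** The linear functional sending 'X^i to [t i], on polynomials of size at most
    [N]; a fixed cutoff [N], rather than the size of P, makes linearity immediate.  For [t]
    the central trinomial coefficients T_i(b,c) it is P |-> CT P(x + b + c/x). *)
Definition umbral_eval (R : comNzRingType) (N : nat) (t : nat -> R)
    (P : {poly R}) : R :=
  \sum_(i < N) P`_i * t i.

Lemma umbral_eval_sum (R : comNzRingType) N t (I : finType) (a : I -> R)
    (P : I -> {poly R}) :
  umbral_eval N t (\sum_i a i *: P i) = \sum_i a i * umbral_eval N t (P i).
Proof.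
under [RHS]eq_bigr do rewrite mulr_sumr.
rewrite exchange_big; apply: eq_bigr => j _ /=.
by rewrite coef_sum mulr_suml; apply: eq_bigr => i _; rewrite coefZ mulrA.
Qed.

Lemma umbral_evalXn (R : comNzRingType) N (t : nat -> R) m :
  (m < N)%N -> umbral_eval N t 'X^m = t m.
Proof.
move=> mN; rewrite /umbral_eval (bigD1 (Ordinal mN)) //= coefXn eqxx mul1r.
rewrite big1 ?addr0 // => i ne; rewrite coefXn -[m]/(val (Ordinal mN)).
by rewrite (inj_eq val_inj) (negbTE ne) mul0r.
Qed.

Lemma central_trinomial_shift (R : comNzRingType) m (b c e : R) :
  central_trinomial m (b + e) c =
    \sum_(i < m.+1) (e ^+ i *+ 'C(m, i)) * central_trinomial (m - i) b c.
Proof.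
rewrite /central_trinomial.
have -> : 'X^2 + (b + e) *: 'X + c%:P = ('X^2 + b *: 'X + c%:P) + e *: 'X.
  by rewrite scalerDl; ring.
rewrite exprDn coef_sum; apply: eq_bigr => i _.
rewrite coefMn exprZn -scalerAr coefZ coefMXn ltnNge -ltnS ltn_ord /=.
by rewrite mulrnAl.
Qed.

(** Adding e to b amounts to substituting 'X + e for 'X in the argument of the
    functional. *)
Lemma umbral_eval_central (R : comNzRingType) N m (b c e : R) :
  (m < N)%N ->
  umbral_eval N (fun i => central_trinomial i b c) (('X + e%:P) ^+ m) =
  central_trinomial m (b + e) c.
Proof.
move=> mN; rewrite central_trinomial_shift exprDn.
under eq_bigr => i _ do
  rewrite -rmorphXn mulrC -mulrnAl -rmorphMn /= mul_polyC.
rewrite umbral_eval_sum; apply: eq_bigr => i _; rewrite umbral_evalXn //.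
by rewrite (leq_ltn_trans (leq_subr _ _)).
Qed.

Lemma central_trinomial_square (R : comNzRingType) k (d : R) :
  central_trinomial k (2 * d) (d ^+ 2) = 'C(k.*2, k)%:R * d ^+ k.
Proof.
rewrite /central_trinomial.
have -> : 'X^2 + (2 * d) *: 'X + (d ^+ 2)%:P = ('X + d%:P) ^+ 2.
  by rewrite -mul_polyC !(rmorphM, rmorphXn) /= rmorph_nat; ring.
rewrite -exprM mul2n exprDn coef_sum.
have kk : (k < k.*2.+1)%N by rewrite ltnS -addnn leq_addr.
rewrite (bigD1 (Ordinal kk)) //= big1 ?addr0 => [|i ne].
  by rewrite -rmorphXn coefMn coefMC -addnn addnK coefXn eqxx mul1r mulr_natl.
rewrite -rmorphXn coefMn coefMC coefXn.
case: eqP => [e|_]; last by rewrite mul0r mul0rn.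
by case/eqP: ne; apply: val_inj => /=; have := ltn_ord i; lia.
Qed.

Lemma coef_comp_scaleX (R : comNzRingType) (P : {poly R}) (l : R) i :
  (P \Po (l *: 'X))`_i = l ^+ i * P`_i.
Proof.
rewrite coef_comp_poly; under eq_bigr => j _ do rewrite exprZn coefZ coefXn.
case: (ltnP i (size P)) => iP.
  rewrite (bigD1 (Ordinal iP)) //= eqxx mulr1 mulrC big1 ?addr0 // => j ne.
  rewrite -[i]/(val (Ordinal iP)) (inj_eq val_inj) eq_sym (negbTE ne).
  by rewrite !mulr0.
rewrite nth_default // mulr0 big1 // => j _.
by case: eqP (ltn_ord j) => [<-|]; rewrite ?ltnNge ?iP // !mulr0.
Qed.

(** Substituting l 'X for 'X multiplies 'X^2 + b 'X + c by l^2 once b and c have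
    been rescaled. *)
Lemma central_trinomial_scale (F : fieldType) m (l b c : F) : l != 0 ->
  central_trinomial m (l * b) (l ^+ 2 * c) = l ^+ m * central_trinomial m b c.
Proof.
move=> l0; rewrite /central_trinomial.
apply: (mulfI (expf_neq0 m l0)); rewrite -coef_comp_scaleX.
have -> : ('X^2 + (l * b) *: 'X + (l ^+ 2 * c)%:P) ^+ m \Po (l *: 'X) =
          l ^+ (m + m) *: (('X^2 + b *: 'X + c%:P) ^+ m).
  rewrite rmorphXn /= !comp_polyD comp_polyZ comp_polyC comp_polyX.
  rewrite comp_Xn_poly.
  rewrite addnn -mul2n exprM -exprZn; congr (_ ^+ m).
  by rewrite -!mul_polyC !rmorphM ?rmorphXn /=; ring.
by rewrite coefZ exprD mulrA.
Qed.

(** Both sides are the image, under the functional attached to T_i(2d, d^2), of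
    one polynomial: U_{2n} expanded at 'X + 2 on the left and at 'X on the
    right. *)
Lemma central_trinomial_sum (R : comNzRingType) n (d : R) :
  \sum_(k < n.+1) (-1) ^+ k * 'C(n + k, k.*2)%:R *
     central_trinomial k.*2 (2 * d + 2) (d ^+ 2) =
  (-1) ^+ n * \sum_(k < n.*2.+1)
     'C(n.*2.+1 + k, k.*2.+1)%:R * ('C(k.*2, k)%:R * d ^+ k).
Proof.
pose L := umbral_eval n.*2.+1 (fun i => central_trinomial i (2 * d) (d ^+ 2)).
have H : \sum_(k < n.+1)
       ((-1) ^+ k * 'C(n + k, k.*2)%:R) *: ('X + 2%:P) ^+ k.*2
   = \sum_(k < n.*2.+1)
       ((-1) ^+ n * 'C(n.*2.+1 + k, k.*2.+1)%:R : R) *: 'X^k.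
  have [] := morgan_voyce_double n ('X : {poly R}) => + _.
  rewrite /morgan_voyce_B /morgan_voyce_b.
  move=> /(congr1 (fun P => (-1) ^+ n * P)).
  rewrite mulrA -exprMn mulrNN mulr1 expr1n mul1r => e.
  apply: (etrans (etrans _ (esym e))).
    apply: eq_bigr => k _; rewrite -mul_polyC rmorphM rmorphXn rmorphN1 /=.
    by rewrite !rmorph_nat [(- _ ^+ 2) ^+ _]exprNn -exprM mul2n; ring.
  rewrite mulr_sumr; apply: eq_bigr => k _.
  by rewrite -mul_polyC rmorphM rmorphXn rmorphN1 /= rmorph_nat mulrA.
have := congr1 L H; rewrite /L !umbral_eval_sum mulr_sumr => HL.
apply: (etrans (etrans _ HL)); apply: eq_bigr => k _.
  by rewrite umbral_eval_central // ltnS leq_double -ltnS ltn_ord.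
by rewrite umbral_evalXn // central_trinomial_square -mulrA.
Qed.

Lemma central_trinomial_pintegral p m (b c : rat) :
  b \in pintegral p -> c \in pintegral p ->
  central_trinomial m b c \in pintegral p.
Proof.
move=> bP cP.
have /polyOverP : ('X^2 + b *: 'X + c%:P) ^+ m \is a polyOver (pintegral p).
  by rewrite rpredX // !rpredD ?polyOverZ ?polyOverC ?polyOverXn ?polyOverX.
by apply.
Qed.

(** * Binomial coefficients modulo the square of a prime *)

Lemma central_binS k : k.+1%:R * 'C(k.+1.*2, k.+1)%:R =
   2 * k.*2.+1%:R * 'C(k.*2, k)%:R :> rat.
Proof.
have e1 : (k.*2.+2 * 'C(k.*2.+1, k) = k.+1 * 'C(k.*2.+2, k.+1))%N.
  exact: mul_bin_diag.
have := mul_bin_down k.*2.+1 k; rewrite /= => e2.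
have e3 : (k.*2.+1 - k = k.+1)%N by lia.
rewrite e3 in e2; rewrite doubleS -!natrM -e1; congr _%:R.
by rewrite -doubleS -mul2n -mulnA -e2 mulnA.
Qed.

Lemma bin_step m j : (j <= m)%N ->
  j.+1%:R * j.+2%:R * 'C(m.+1, j.+2)%:R =
  m.+1%:R * (m - j)%N%:R * 'C(m, j)%:R :> rat.
Proof.
move=> jm; rewrite -mulrA -[_ * 'C(m.+1, _)%:R]natrM -mul_bin_diag natrM.
by rewrite mulrCA -[_ * 'C(m, j.+1)%:R]natrM mul_bin_left natrM mulrA.
Qed.

(** Going from k to k + 1 multiplies the left side by (2k+1)^2 / D and the right
    side by ((2k+1)^2 - p^2) / D, where D = 4 (2k+1) (2k+2) is prime to p. *)
Lemma central_bin_cong p n k : prime p -> p = n.*2.+1 -> (k <= n)%N ->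
  pcong p (p ^ 2) ('C(k.*2, k)%:R / 16 ^+ k) ((-1) ^+ k * 'C(n + k, k.*2)%:R).
Proof.
move=> p_pr pE; have p0 : p%:R != 0 :> rat by rewrite pnatr_eq0 pE.
have inv2 : 2^-1 \in pintegral p.
  by apply: pintegral_inv; rewrite coprimen2 pE /= odd_double.
elim: k => [_|k IH kn]; first by rewrite double0 !bin0 !expr0 divr1 pcong_refl.
move: IH => /(_ (ltnW kn)) IH.
have i1 : k.+1%:R^-1 \in pintegral p by apply: pintegral_inv_lt; lia.
have i2 : k.*2.+1%:R^-1 \in pintegral p by apply: pintegral_inv_lt; lia.
have u1 : k.+1%:R != 0 :> rat by rewrite pnatr_eq0.
have u2 : k.*2.+1%:R != 0 :> rat by rewrite pnatr_eq0.
have ex : 'C(k.+1.*2, k.+1)%:R =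
    2 * k.*2.+1%:R * 'C(k.*2, k)%:R / k.+1%:R :> rat.
  by rewrite -central_binS mulrC mulKf.
have ey : 'C(n + k.+1, k.+1.*2)%:R =
    (n + k).+1%:R * (n - k)%N%:R / (k.*2.+1%:R * (2 * k.+1%:R)) *
    'C(n + k, k.*2)%:R :> rat.
  have h : (k.*2 <= n + k)%N by lia.
  have e3 : (n + k - k.*2 = n - k)%N by lia.
  have e4 : k.*2.+2%:R = 2 * k.+1%:R :> rat by rewrite -doubleS -mul2n natrM.
  have := bin_step h; rewrite e3 e4 => e.
  apply: (mulfI (mulf_neq0 u2 (mulf_neq0 (isT : 2 != 0 :> rat) u1))).
  rewrite addnS doubleS e.
  move: (k.+1%:R) (k.*2.+1%:R) u1 u2 => v w u1 u2.
  by field; rewrite u1 u2.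
have ez : (n + k).+1%:R * (n - k)%N%:R =
    (p%:R ^+ 2 - k.*2.+1%:R ^+ 2) / 4 :> rat.
  rewrite natrB; last exact: ltnW.
  by rewrite pE -!natr1 natrD -!mul2n !natrM; field.
rewrite ey ez ex exprS; move: IH; rewrite /pcong natrX.
set x := _%:R / _; set y := (-1) ^+ k * _ => IH.
have -> : (2 * k.*2.+1%:R * 'C(k.*2, k)%:R / k.+1%:R / (16 * 16 ^+ k) -
   (-1) ^+ k.+1 * ((p%:R ^+ 2 - k.*2.+1%:R ^+ 2) / 4 /
     (k.*2.+1%:R * (2 * k.+1%:R)) * 'C(n + k, k.*2)%:R)) / p%:R ^+ 2 =
   (x - y) / p%:R ^+ 2 * k.*2.+1%:R * k.+1%:R^-1 * 2^-1 ^+ 3 +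
   y * k.+1%:R^-1 * k.*2.+1%:R^-1 * 2^-1 ^+ 3.
  rewrite /x /y (exprS (-1)).
  move: ((-1) ^+ k) 'C(_, _)%:R 'C(_, _)%:R u1 u2 => s b c.
  move: k.+1%:R k.*2.+1%:R => v w u1 u2.
  by field; rewrite expf_neq0 // p0 u1 u2.
have yP : y \in pintegral p.
  by rewrite rpredM ?rpredX ?rpredN ?rpred1 ?rpred_nat.
move: IH yP; move: (y) ((x - y) / _) => r q qP rP.
by rewrite rpredD ?rpredM ?rpredX ?rpred_nat.
Qed.

(** The only odd multiple of p among the 2k+1 < 2p is p itself. *)
Lemma pintegral_p_odd p k : prime p -> odd p -> (k < p)%N ->
  p%:R / k.*2.+1%:R \in pintegral p.
Proof.
move=> p_pr p_odd kp; case: (eqVneq p k.*2.+1) => [e|kn].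
  by rewrite -e divff ?rpred1 // pnatr_eq0 e.
rewrite rpredM ?rpred_nat // pintegral_inv // prime_coprime //.
by apply/negP => /dvdnP[q]; case: q => [|[|q]]; lia.
Qed.

(** Multiplied by (2k+1) (-1)^k, the left side changes by the factor
    1 - p^2/(k+1)^2 from k to k + 1, hence stays congruent to p modulo p^3.
    The modulus p^3 leaves room for dividing by 2k+1, which may equal p. *)
Lemma odd_bin_central_cong p k : prime p -> odd p -> (k < p)%N ->
  pcong p (p ^ 2) ('C(p + k, k.*2.+1)%:R * 'C(k.*2, k)%:R)
                  (p%:R / k.*2.+1%:R * (-1) ^+ k).
Proof.
move=> p_pr p_odd kp.
have p0 : p%:R != 0 :> rat by rewrite pnatr_eq0 -lt0n prime_gt0.
have H : pcong p (p ^ 3)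
   ('C(p + k, k.*2.+1)%:R * 'C(k.*2, k)%:R * k.*2.+1%:R * (-1) ^+ k) p%:R.
  elim: k kp => [_|k IH kp].
    by rewrite addn0 bin1 bin0 !mulr1 pcong_refl.
  move: IH => /(_ (ltnW kp)) IH.
  have i1 : k.+1%:R^-1 \in pintegral p by apply: pintegral_inv_lt; lia.
  have u1 : k.+1%:R != 0 :> rat by rewrite pnatr_eq0.
  have ex : 'C(k.+1.*2, k.+1)%:R =
      2 * k.*2.+1%:R * 'C(k.*2, k)%:R / k.+1%:R :> rat.
    by rewrite -central_binS mulrC mulKf.
  have ey : k.+1.*2.+1%:R * 'C(p + k.+1, k.+1.*2.+1)%:R =
      (p%:R ^+ 2 - k.+1%:R ^+ 2) / (2 * k.+1%:R) *
      'C(p + k, k.*2.+1)%:R :> rat.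
    have h : (k.*2.+1 <= p + k)%N by lia.
    have e3 : (p + k - k.*2.+1 = p - k.+1)%N by lia.
    have e4 : k.*2.+2%:R = 2 * k.+1%:R :> rat by rewrite -doubleS -mul2n natrM.
    have := bin_step h; rewrite e3 e4 natrB; last exact: ltnW.
    move=> e; apply: (mulfI (mulf_neq0 (isT : 2 != 0 :> rat) u1)).
    rewrite mulrA addnS doubleS e -(natr1 (p + k)) natrD -(natr1 k).
    by move: u1; rewrite -(natr1 k) => u1; field.
  set A := (X in pcong _ _ X _) in IH.
  have -> : 'C(p + k.+1, k.+1.*2.+1)%:R * 'C(k.+1.*2, k.+1)%:R *
      k.+1.*2.+1%:R * (-1) ^+ k.+1 = A * (1 - p%:R ^+ 2 * k.+1%:R^-1 ^+ 2).
    rewrite [_ * k.+1.*2.+1%:R]mulrC [k.+1.*2.+1%:R * (_ * _)]mulrA ey ex /A.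
    by rewrite (exprS (-1)); move: (k.+1%:R) u1 => v u1; field.
  have rP : 1 - p%:R ^+ 2 * k.+1%:R^-1 ^+ 2 \in pintegral p.
    by rewrite rpredB ?rpred1 ?rpredM ?rpredX ?rpred_nat.
  apply: (pcong_trans (pcongMr rP IH)); rewrite /pcong natrX.
  have -> : (p%:R * (1 - p%:R ^+ 2 * k.+1%:R^-1 ^+ 2) - p%:R) / p%:R ^+ 3 =
      - k.+1%:R^-1 ^+ 2 :> rat.
    by move: (k.+1%:R) u1 => v u1; field; rewrite p0 u1.
  by rewrite rpredN rpredX.
have oP := pintegral_p_odd p_pr p_odd kp.
have u2 : k.*2.+1%:R != 0 :> rat by rewrite pnatr_eq0.
move: H; rewrite /pcong !natrX => H.
set s := (-1) ^+ k in H *.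
have s2 : s * s = 1 by rewrite -exprMn mulrNN mulr1 expr1n.
have sP : s \in pintegral p by rewrite rpredX ?rpredN ?rpred1.
set A := (X in X / _ \in _) in H.
rewrite [X in X \in _](_ : _ = A / p%:R ^+ 3 * (p%:R / k.*2.+1%:R) * s).
  by apply: rpredM => //; exact: rpredM.
rewrite /A; move: ('C(_, _)%:R) ('C(_, _)%:R) => y x.
move: (k.*2.+1%:R) u2 => v u2.
transitivity ((x * y * (s * s) - p%:R / v * s) / p%:R ^+ 2).
  by rewrite s2 mulr1 [x * y]mulrC.
by field; rewrite p0 u2.
Qed.

Lemma bin_pred_cong p i : prime p -> (i < p)%N ->
  pcong p p ((-1) ^+ i * 'C(p.-1, i)%:R) 1.
Proof.
move=> p_pr; have p0 : p%:R != 0 :> rat by rewrite pnatr_eq0 -lt0n prime_gt0.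
elim: i => [_|i IH ip]; first by rewrite bin0 mulr1 pcong_refl.
apply: pcong_trans (IH (ltnW ip)).
have /dvdnP[q e] : (p %| 'C(p, i.+1))%N by apply: prime_dvd_bin; rewrite ?ip.
have : 'C(p, i.+1)%:R = 'C(p.-1, i.+1)%:R + 'C(p.-1, i)%:R :> rat.
  by rewrite -natrD -binS prednK // prime_gt0.
rewrite e natrM /pcong exprS => eq.
have -> : (-1 * (-1) ^+ i * 'C(p.-1, i.+1)%:R - (-1) ^+ i * 'C(p.-1, i)%:R) /
    p%:R = - (-1) ^+ i * q%:R :> rat.
  have -> : 'C(p.-1, i.+1)%:R = q%:R * p%:R - 'C(p.-1, i)%:R :> rat.
    by rewrite eq addrK.
  by field.
by rewrite rpredM ?rpredN ?rpredX ?rpredN ?rpred1 ?rpred_nat.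
Qed.

(** C(p,j) = (p/j) C(p-1,j-1), and C(p-1,j-1) is (-1)^(j-1) modulo p. *)
Lemma inv_bin_cong p j : prime p -> (0 < j < p)%N ->
  pcong p (p ^ 2) (p%:R / j%:R) ((-1) ^+ j.-1 * 'C(p, j)%:R).
Proof.
move=> p_pr; have p0 : p%:R != 0 :> rat by rewrite pnatr_eq0 -lt0n prime_gt0.
case: j => // i /andP[_ ip].
have iP : i.+1%:R^-1 \in pintegral p by apply: pintegral_inv_lt; rewrite ?ip.
have u : i.+1%:R != 0 :> rat by rewrite pnatr_eq0.
have e : 'C(p, i.+1)%:R = p%:R * 'C(p.-1, i)%:R / i.+1%:R :> rat.
  apply: (mulfI u); rewrite -[LHS]natrM -mul_bin_diag natrM.
  by move: i.+1%:R u => v u; field.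
have h := pcong_sym (bin_pred_cong p_pr (ltnW ip)).
rewrite /pcong e natrX /=.
rewrite [X in X \in _](_ : _ = (1 - (-1) ^+ i * 'C(p.-1, i)%:R) / p%:R / i.+1%:R).
  exact: rpredM.
by move: i.+1%:R u => v u; field; rewrite p0 u.
Qed.

(** The difference of the two sides is p^2 / (j (p+j)). *)
Lemma inv_shift_cong p j : prime p -> (0 < j < p)%N ->
  pcong p (p ^ 2) (p%:R / (p + j)%:R) (p%:R / j%:R).
Proof.
move=> p_pr jp; have jP : j%:R^-1 \in pintegral p by apply: pintegral_inv_lt.
have p0 : p%:R != 0 :> rat by rewrite pnatr_eq0 -lt0n prime_gt0.
have pjP : (p + j)%:R^-1 \in pintegral p.
  apply: pintegral_inv; rewrite prime_coprime // dvdn_addr //.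
  by rewrite gtnNdvd //; case/andP: jp.
have u : j%:R != 0 :> rat by rewrite pnatr_eq0 -lt0n; case/andP: jp.
have u' : (p + j)%:R != 0 :> rat.
  by rewrite pnatr_eq0 addn_eq0 negb_and -lt0n prime_gt0.
rewrite /pcong natrX [X in X \in _](_ : _ = - (j%:R^-1 * (p + j)%:R^-1)).
  by rewrite rpredN rpredM.
by move: u'; rewrite natrD => u'; field; rewrite p0 u u'.
Qed.

(** * Powers of one plus a square root *)

(** (1 + sqrt a)^m = pow_even m a + pow_odd m a * sqrt a, without adjoining the
    square root to R. *)
Definition pow_even (R : comNzRingType) (m : nat) (a : R) : R :=
  \sum_(i < m.+1) 'C(m, i.*2)%:R * a ^+ i.

Definition pow_odd (R : comNzRingType) (m : nat) (a : R) : R :=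
  \sum_(i < m.+1) 'C(m, i.*2.+1)%:R * a ^+ i.

Lemma pow_evenS (R : comNzRingType) m (a : R) :
  pow_even m.+1 a = pow_even m a + a * pow_odd m a.
Proof.
have -> : pow_even m a = \sum_(i < m.+2) 'C(m, i.*2)%:R * a ^+ i.
  by rewrite big_ord_recr /= bin_small ?mul0r ?addr0 //; lia.
rewrite /pow_even /pow_odd [LHS]big_ord_recl [in RHS]big_ord_recl.
rewrite double0 !bin0 -addrA; congr (_ + _).
rewrite mulr_sumr -big_split /=; apply: eq_bigr => k _.
by rewrite /bump /= add1n doubleS binS natrD exprS; ring.
Qed.

Lemma pow_oddS (R : comNzRingType) m (a : R) :
  pow_odd m.+1 a = pow_even m a + pow_odd m a.
Proof.
have -> : pow_even m a = \sum_(i < m.+2) 'C(m, i.*2)%:R * a ^+ i.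
  by rewrite big_ord_recr /= bin_small ?mul0r ?addr0 //; lia.
have -> : pow_odd m a = \sum_(i < m.+2) 'C(m, i.*2.+1)%:R * a ^+ i.
  by rewrite big_ord_recr /= bin_small ?mul0r ?addr0 //; lia.
rewrite /pow_odd -big_split /=; apply: eq_bigr => k _.
by rewrite binS natrD; ring.
Qed.

Lemma pow_even0 (R : comNzRingType) (a : R) : pow_even 0 a = 1.
Proof. by rewrite /pow_even big_ord1 mulr1. Qed.

Lemma pow_odd0 (R : comNzRingType) (a : R) : pow_odd 0 a = 0.
Proof. by rewrite /pow_odd big_ord1 mul0r. Qed.

Lemma sum_ord_trunc (R : nmodType) (N M : nat) (f : nat -> R) :
  (N <= M)%N -> (forall k, (N <= k)%N -> f k = 0) ->
  \sum_(k < M) f k = \sum_(k < N) f k.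
Proof.
move=> NM f0; rewrite (big_ord_widen M f NM) [RHS]big_mkcond.
by apply: eq_bigr => i _; case: ltnP => // /f0.
Qed.

Lemma pow_even_double (R : comNzRingType) n (a : R) :
  pow_even n.*2.+1 a =
    1 + \sum_(i < n) 'C(n.*2.+1, i.*2.+2)%:R * a ^+ i.+1.
Proof.
rewrite /pow_even.
rewrite (@sum_ord_trunc _ n.+1 _ (fun i => 'C(n.*2.+1, i.*2)%:R * a ^+ i)).
- by rewrite big_ord_recl /= double0 bin0 expr0 mulr1.
- by lia.
- by move=> k kn; rewrite bin_small ?mul0r //; lia.
Qed.

Lemma pow_odd_double (R : comNzRingType) n (a : R) :
  pow_odd n.*2.+1 a =
    \sum_(i < n) 'C(n.*2.+1, i.*2.+1)%:R * a ^+ i + a ^+ n.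
Proof.
rewrite /pow_odd.
rewrite (@sum_ord_trunc _ n.+1 _ (fun i => 'C(n.*2.+1, i.*2.+1)%:R * a ^+ i)).
- by rewrite big_ord_recr /= binn mul1r.
- by lia.
- by move=> k kn; rewrite bin_small ?mul0r //; lia.
Qed.

Lemma pow_odd_mod (p n : nat) (a : int) : prime p -> p = n.*2.+1 ->
  (p%:Z %| pow_odd p a - a ^+ n)%Z.
Proof.
move=> p_pr pE.
rewrite (_ : pow_odd p a = pow_odd n.*2.+1 a); last by rewrite -pE.
rewrite pow_odd_double addrK; apply: rpred_sum => i _.
apply: dvdz_mulr; rewrite natz -pE dvdzE /= prime_dvd_bin //.
by have := ltn_ord i; lia.
Qed.

(** The induction step is (1 + i)^2 = 2 i. *)
Lemma pow_odd_m1 (R : comNzRingType) n :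
  pow_odd n.*2.+1 (-1) = (-1) ^+ n * pow_even n.*2.+1 (-1) :> R.
Proof.
elim: n => [|n IH].
  by rewrite pow_oddS pow_evenS pow_even0 pow_odd0; ring.
have s2 : (-1) ^+ n * (-1) ^+ n = 1 :> R.
  by rewrite -exprMn mulrNN mulr1 expr1n.
rewrite doubleS !(pow_oddS _.+1) !(pow_evenS _.+1) (pow_oddS _.+1) IH exprS.
transitivity (((-1) ^+ n * (-1) ^+ n) * pow_even n.*2.+1 (-1) *+ 2 : R).
  by rewrite s2; ring.
by ring.
Qed.

Lemma pow_even_odd_4 (R : comNzRingType) m :
  2 * pow_even m 4 = 3 ^+ m + (-1) ^+ m :> R /\
  4 * pow_odd m 4 = 3 ^+ m - (-1) ^+ m :> R.
Proof.
elim: m => [|m [IHe IHo]].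
  by rewrite pow_even0 pow_odd0; split; ring.
rewrite pow_evenS pow_oddS (exprS 3) (exprS (-1)); split.
  have -> : 2 * (pow_even m 4 + 4 * pow_odd m 4) =
      2 * pow_even m 4 + 2 * (4 * pow_odd m 4) :> R by ring.
  by rewrite IHe IHo; ring.
have -> : 4 * (pow_even m 4 + pow_odd m 4) =
    2 * (2 * pow_even m 4) + 4 * pow_odd m 4 :> R by ring.
by rewrite IHe IHo; ring.
Qed.

(** (1 + sqrt(-3)) / 2 is a sixth root of unity. *)
Lemma pow_even_odd_m3 (R : comNzRingType) q r :
  pow_even (6 * q + r) (-3) = 64 ^+ q * pow_even r (-3) :> R /\
  pow_odd (6 * q + r) (-3) = 64 ^+ q * pow_odd r (-3) :> R.
Proof.
elim: q => [|q [IHe IHo]]; first by rewrite !mul1r.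
have -> : (6 * q.+1 + r = (6 * q + r).+4.+2)%N by lia.
by rewrite !(pow_evenS, pow_oddS) IHe IHo (exprS 64); split; ring.
Qed.

(** The sign is chosen before the ring: it is used both over the integers, where
    it is read off modulo p, and over the rationals. *)
Lemma pow_even_odd_m3_prime (p n : nat) :
  prime p -> p = n.*2.+1 -> p != 3 ->
  exists b : bool, forall R : comNzRingType,
  pow_even p (-3) = 4 ^+ n :> R /\ pow_odd p (-3) = (-1) ^+ b * 4 ^+ n :> R.
Proof.
move=> p_pr pE p3.
have p3' : (p %% 3 != 0)%N.
  by apply: contraNneq p3 => /eqP; rewrite -/(3 %| p)%N dvdn_prime2 // eq_sym.
have E64 (R : comNzRingType) q : 64 ^+ q = 4 ^+ (3 * q) :> R.
  by rewrite exprM; congr (_ ^+ q); ring.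
have [rE|rE] : n = (3 * (p %/ 6))%N \/ n = (3 * (p %/ 6)).+2 by lia.
  exists false => R; have -> : p = (6 * (p %/ 6) + 1)%N by lia.
  have [-> ->] := pow_even_odd_m3 R (p %/ 6) 1.
  by rewrite rE -E64 pow_evenS pow_oddS pow_even0 pow_odd0; split; ring.
exists true => R; have -> : p = (6 * (p %/ 6) + 5)%N by lia.
have [-> ->] := pow_even_odd_m3 R (p %/ 6) 5.
rewrite rE -(addn2 (3 * _)) exprD -E64.
by rewrite !(pow_evenS, pow_oddS) pow_even0 pow_odd0; split; ring.
Qed.

(** * Reduction of the sums to powers of one plus a square root *)

(** The sum is the odd part of p (x + x^2/2 + ...) with x^2 = a, divided by x and
    cut at degree 2p.  The term 2k+1 = p gives a^n; below it
    p/j is congruent to C(p,j) for j = 2k+1 odd, above it p/(p+j) is congruent to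
    - C(p,j) for j = 2k+1-p even, with a^k = a^n a^(j/2). *)
Lemma odd_log_cong p n (a : rat) :
  prime p -> p = n.*2.+1 -> a \in pintegral p ->
  pcong p (p ^ 2) (\sum_(k < p) p%:R / k.*2.+1%:R * a ^+ k)
    (pow_odd p a + a ^+ n * (1 - pow_even p a)).
Proof.
move=> p_pr pE aP.
have sumE m : p = m -> \sum_(k < p) p%:R / k.*2.+1%:R * a ^+ k =
    \sum_(k < m) p%:R / k.*2.+1%:R * a ^+ k by move=> <-.
rewrite (sumE (n + n.+1)%N); last by rewrite pE addnS addnn.
rewrite big_split_ord big_ord_recl /= addn0 -pE divff ?mul1r; last first.
  by rewrite pnatr_eq0 pE.
rewrite (_ : pow_odd p a = pow_odd n.*2.+1 a); last by rewrite -pE.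
rewrite (_ : pow_even p a = pow_even n.*2.+1 a); last by rewrite -pE.
rewrite pow_odd_double pow_even_double -pE -addrA.
apply: pcongD.
  apply: pcong_sum => k _; apply: pcongMr; first exact: rpredX.
  have := @inv_bin_cong p k.*2.+1 p_pr.
  rewrite /= -mul2n exprM sqrrN expr1n.
  by rewrite mul1r; apply; have := ltn_ord k; lia.
apply: pcongD; first exact: pcong_refl.
rewrite opprD addrA subrr add0r mulrN mulr_sumr -sumrN.
apply: pcong_sum => k _; rewrite /bump /= add1n addnS exprS exprD.
have -> : (n + k).+1.*2.+1 = (p + k.*2.+2)%N by rewrite pE; lia.
have kp : (0 < k.*2.+2 < p)%N by have := ltn_ord k; lia.
have h := pcong_trans (inv_shift_cong p_pr kp) (inv_bin_cong p_pr kp).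
have rP : a * (a ^+ n * a ^+ k) \in pintegral p by rewrite !rpredM ?rpredX.
apply: (pcong_trans (pcongMr rP h)).
set lhs := (X in pcong _ _ X _); set rhs := (X in pcong _ _ _ X).
suff -> : lhs = rhs by exact: pcong_refl.
by rewrite /lhs /rhs /= (exprS (-1)) (exprS a) -mul2n exprM sqrrN expr1n; ring.
Qed.

Lemma trinomial_sum_cong p n (d : rat) :
  prime p -> p = n.*2.+1 -> d \in pintegral p ->
  pcong p (p ^ 2)
    (\sum_(k < n.+1) 'C(k.*2, k)%:R / 16 ^+ k *
       central_trinomial k.*2 (2 * d + 2) (d ^+ 2))
    ((-1) ^+ n * (pow_odd p (- d) + (- d) ^+ n * (1 - pow_even p (- d)))).
Proof.
move=> p_pr pE dP.
have p_odd : odd p by rewrite pE /= odd_double.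
apply: (@pcong_trans _ _ (\sum_(k < n.+1) (-1) ^+ k * 'C(n + k, k.*2)%:R *
     central_trinomial k.*2 (2 * d + 2) (d ^+ 2))).
  apply: pcong_sum => k _; apply: pcongMr.
    apply: central_trinomial_pintegral; last exact: rpredX.
    by rewrite rpredD ?rpredM ?rpred_nat.
  by apply: central_bin_cong => //; rewrite -ltnS.
rewrite central_trinomial_sum -pE; apply: pcongMl.
  by rewrite rpredX ?rpredN ?rpred1.
apply: pcong_trans (odd_log_cong p_pr pE _); last by rewrite rpredN.
apply: pcong_sum => k _; rewrite mulrA exprNn mulrA; apply: pcongMr.
  exact: rpredX.
exact: (odd_bin_central_cong p_pr p_odd (ltn_ord k)).
Qed.

(** * The three congruences *)

Lemma big_nat_double_form n (c b e : rat) :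
  \sum_(0 <= k < n.+1)
     'C(2 * k, k)%:R / c ^+ k * central_trinomial (2 * k) b e =
  \sum_(k < n.+1) 'C(k.*2, k)%:R / c ^+ k * central_trinomial k.*2 b e.
Proof. by rewrite big_mkord; apply: eq_bigr => k _; rewrite mul2n. Qed.

Theorem corollary1p1 (p : nat) (p_prime : prime p) (p_gt3 : (3 < p)%N) :
  [/\ eqmod_pint p (p ^ 2)
        (\sum_(0 <= k < ((p - 1) %/ 2).+1)
           'C(2 * k, k)%:R / 16%:R ^+ k * central_trinomial (2 * k) (4 : rat) 1)
        1,
      eqmod_pint p (p ^ 2)
        (\sum_(0 <= k < ((p - 1) %/ 2).+1)
           'C(2 * k, k)%:R / 4%:R ^+ k * central_trinomial (2 * k) (3 : rat) 4)
        ((legendre p (-1))%:~R * ((7 - 3 ^+ p) / 4)) &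
      eqmod_pint p (p ^ 2)
        (\sum_(0 <= k < ((p - 1) %/ 2).+1)
           'C(2 * k, k)%:R / 16%:R ^+ k * central_trinomial (2 * k) (8 : rat) 9)
        (legendre p 3)%:~R].
Proof.
pose n := ((p - 1) %/ 2)%N; rewrite -/n.
have pE : p = n.*2.+1.
  by have := even_prime p_prime; rewrite /n; lia.
have p2 : (0 < p ^ 2)%N by rewrite expn_gt0 prime_gt0.
have iP (z : int) : z%:~R \in pintegral p by rewrite rpred_int.
have i4 : 4^-1 \in pintegral p by apply: pintegral_inv_lt; rewrite ?p_gt3 //; lia.
have s2 (R : comNzRingType) (k : nat) : (-1) ^+ k * (-1) ^+ k = 1 :> R.
  by rewrite -exprMn mulrNN mulr1 expr1n.
rewrite !big_nat_double_form; split; apply: pcong_eqmod_pint => //.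
- exact: rpred1.
- have := trinomial_sum_cong p_prime pE (rpred1 _).
  rewrite (_ : pow_odd p (-1) = (-1) ^+ n * pow_even p (-1)); last first.
    by rewrite pE pow_odd_m1.
  rewrite (_ : 2 * 1 + 2 = 4 :> rat); last by ring.
  rewrite expr1n mulrBr mulr1 addrCA subrr addr0 s2.
  exact.
- by rewrite rpredM // rpredM ?rpredB ?rpredX ?rpred_nat.
- have -> : legendre p (-1) = (-1) ^+ n.
    apply: (legendre_euler p_prime pE); last by rewrite subrr dvdz0.
    by rewrite -signr_odd; case: odd.
  have d4 : - 4 \in pintegral p by rewrite rpredN rpred_nat.
  have := trinomial_sum_cong p_prime pE d4.
  rewrite opprK (_ : 2 * - 4 + 2 = - 2 * 3 :> rat); last by ring.
  rewrite (_ : (- 4) ^+ 2 = (- 2) ^+ 2 * 4 :> rat); last by ring.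
  under eq_bigr => k _.
    rewrite central_trinomial_scale // -mul2n (exprM (- 2)) sqrrN mulrA.
    rewrite (_ : _ / 16 ^+ k * _ = 'C(2 * k, k)%:R / 4 ^+ k :> rat); last first.
      rewrite (_ : 16 = 4 * 4 :> rat) ?exprMn; last by ring.
      by field; rewrite expf_neq0.
    rewrite mul2n; over.
  move=> h; apply: pcong_trans h _.
  rewrite rmorphXn /=; apply: pcongMl; first by rewrite rpredX ?rpredN ?rpred1.
  have [e4 o4] := pow_even_odd_4 rat p.
  have n1 : (-1) ^+ p = -1 :> rat.
    by rewrite pE exprS -mul2n exprM sqrrN !expr1n mulr1.
  rewrite n1 in e4 o4.
  have tE : 3 ^+ p = (3 ^+ p : int)%:~R :> rat by rewrite rmorphXn.
  have qE : 4 ^+ n = (4 ^+ n : int)%:~R :> rat by rewrite rmorphXn.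
  (* clear the common denominator 4 and compare integers *)
  have -> : pow_odd p 4 + 4 ^+ n * (1 - pow_even p 4) =
     (3 ^+ p + 1 + 4 ^+ n * (6 - 2 * 3 ^+ p))%:~R / 4 :> rat.
    have -> : pow_odd p 4 = (3 ^+ p + 1) / 4 :> rat.
      by apply: (@mulfI _ 4) => //; rewrite o4; field.
    have -> : pow_even p 4 = (3 ^+ p - 1) / 2 :> rat.
      by apply: (@mulfI _ 2) => //; rewrite e4; field.
    by rewrite tE qE; field.
  have -> : (7 - 3 ^+ p) / 4 = (7 - 3 ^+ p)%:~R / 4 :> rat.
    by rewrite tE; field.
  apply: pcongMr => //; apply: pcong_int.
  have -> : 3 ^+ p + 1 + 4 ^+ n * (6 - 2 * 3 ^+ p) - (7 - 3 ^+ p)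
    = (3 ^+ p - 3) * (4 ^+ n - 1) * (- 2) :> int by ring.
  by rewrite -mulnn PoszM dvdz_mulr // dvdz_mul ?fermat_int // fermat_four.
have p_neq3 : p != 3%N by rewrite neq_ltn p_gt3 orbT.
have [b bE] := pow_even_odd_m3_prime p_prime pE p_neq3.
(* pow_odd p (-3) = (-1)^b 4^n is (-3)^n modulo p, and 4^n is 1 *)
have pb : (p%:Z %| (-1) ^+ b - (-3) ^+ n)%Z.
  have [_ oZ] := bE int; have := pow_odd_mod (-3) p_prime pE.
  rewrite oZ => h.
  have -> : (-1) ^+ b - (-3) ^+ n =
    ((-1) ^+ b * 4 ^+ n - (-3) ^+ n) - (-1) ^+ b * (4 ^+ n - 1) :> int by ring.
  by rewrite rpredB // dvdz_mull // fermat_four.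
have -> : legendre p 3 = (-1) ^+ n * (-1) ^+ b.
  apply: (legendre_euler p_prime pE).
    by rewrite -signr_odd; case: (odd n); case: b {bE pb}.
  have -> : 3 ^+ n - (-1) ^+ n * (-1) ^+ b =
      - (-1) ^+ n * ((-1) ^+ b - (-3) ^+ n) :> int.
    transitivity
      (((-1) ^+ n * (-1) ^+ n) * 3 ^+ n - (-1) ^+ n * (-1) ^+ b : int).
      by rewrite s2 mul1r.
    by rewrite [(-3) ^+ n]exprNn; ring.
  exact: dvdz_mull.
have d3 : 3 \in pintegral p by rewrite rpred_nat.
have := trinomial_sum_cong p_prime pE d3.
rewrite (_ : 2 * 3 + 2 = 8 :> rat); last by ring.
rewrite (_ : 3 ^+ 2 = 9 :> rat); last by ring.
have [-> ->] := bE rat.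
move=> h; apply: pcong_trans h _.
rewrite rmorphM rmorphXn rmorphN1 /=; apply: pcongMl.
  by rewrite rpredX ?rpredN ?rpred1.
have -> : (-1) ^+ b * 4 ^+ n + (- 3) ^+ n * (1 - 4 ^+ n) =
   ((-1) ^+ b * 4 ^+ n + (- 3) ^+ n * (1 - 4 ^+ n))%:~R :> rat.
  by rewrite rmorphD !rmorphM rmorphB !rmorphXn rmorphN1 rmorph1.
apply: pcong_int.
have -> : (-1) ^+ b * 4 ^+ n + (- 3) ^+ n * (1 - 4 ^+ n) - (-1) ^+ b =
  ((-1) ^+ b - (- 3) ^+ n) * (4 ^+ n - 1) :> int by ring.
by rewrite -mulnn PoszM dvdz_mul // fermat_four.
Qed.
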